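(* Let $R$ be a subring of $\mathbb{Q}$, let $n\ge 1$ be an integer, and let $G$ be a group of type $R\text{-}FP_{n+1}$. Then the $n$-th filling function $FV_{G,R}^{n+1}\colon\mathbb{N}\to[0,\infty]$ of $G$ is well defined up to the equivalence relation $\sim$; that is, any two functions obtained from the definition of $FV_{G,R}^{n+1}$ by different choices (of the partial projective resolution, of the integral part $K_n$, and of the filling norms) are equivalent under $\sim$.
   Context: Rings have an identity. $R$ is a subring of $\mathbb{Q}$ normed by the absolute value. A group $G$ is of type $R\text{-}FP_{m}$ if the trivial $RG$-module $R$ admits a partial projective resolution $P_m\to\cdots\to P_1\to P_0\to R\to 0$ (exact) with each $P_i$ a finitely generated projective $RG$-module. Norms. The group ring $RG$ carries the $\ell_1$-norm $|\sum_g r_g g| = \sum_g |r_g|$. A free $RG$-module $F$ with fixed basis $\Lambda$ carries the $\ell_1$-norm $\|\sum_{x\in\Lambda} a_x x\|_1=\sum_{x\in\Lambda}|a_x|$. A filling norm on a finitely generated $RG$-module $M$ is a function of the form $\|m\|_M=\inf\{\|x\|_1 : x\in F,\ \rho(x)=m\}$, where $\rho\colon F\to M$ is a surjective $RG$-morphism from a finitely generated free $RG$-module $F$ with fixed finite basis. Integral part. An integral part of a finitely generated $RG$-module $P$ is a $\mathbb{Z}G$-submodule $A\subseteq P$ that is finitely generated as a $\mathbb{Z}G$-module and generates $P$ as an $RG$-module. Filling function. Choose a partial projective resolution $P_{n+1}\xrightarrow{\partial_{n+1}}P_n\xrightarrow{\partial_n}\cdots\xrightarrow{\partial_1}P_0\to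 R\to 0$ of the trivial $RG$-module $R$ by finitely generated projective $RG$-modules, an integral part $K_n$ of $\ker(\partial_n)$, and filling norms $\|\cdot\|_{P_n}$, $\|\cdot\|_{P_{n+1}}$ on $P_n$, $P_{n+1}$. Then \[FV_{G,R}^{n+1}(k)=\sup\{\|\gamma\|_{\partial_{n+1}} : \gamma\in K_n,\ \|\gamma\|_{P_n}\le k\},\qquad \|\gamma\|_{\partial_{n+1}}=\inf\{\|\mu\|_{P_{n+1}} : \mu\in P_{n+1},\ \partial_{n+1}(\mu)=\gamma\},\] with the supremum of the empty set being $0$. Equivalence. For non-decreasing functions $f,g\colon\mathbb{N}\to[0,\infty]$, $f\preceq g$ means that there is $C>0$ (taken to be an integer, so that $g(Ck+C)$ makes sense) such that $f(k)\le C\,g(Ck+C)+Ck+C$ for all $k\in\mathbb{N}$; and $f\sim g$ means $f\preceq g$ and $g\preceq f$. *)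

(* Defs.v *)
From HB Require Import structures.
From mathcomp Require Import all_boot all_order all_algebra finmap.
From mathcomp Require Import monalg.
From mathcomp Require Import boolp classical_sets reals constructive_ereal ereal.

Set Implicit Arguments.
Unset Strict Implicit.
Unset Printing Implicit Defensive.

Import Order.TTheory GRing.Theory Num.Theory.

Local Open Scope ring_scope.

(* The subring R of the rationals, as a type. *)
Definition subrat (R : subringClosed rat) : Type := {x : rat | x \in R}.
HB.instance Definition _ (R : subringClosed rat) := SubChoice.on (subrat R).
HB.instance Definition _ (R : subringClosed rat) :=
  [SubChoice_isSubComNzRing of subrat R by <:].

(* The group ring A[G].  The additive group is that of the finitely supported
   functions {malg A[G]}; the alias carries the convolution product (monalg
   only provides one for monoids without nontrivial units). *)
Definition group_ring (A : nzRingType) (G : groupType) : Type := {malg A[G]}.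

Section GroupRing.
Local Open Scope fset_scope.
Local Open Scope ring_scope.
Variables (A : nzRingType) (G : groupType).
Local Notation AG := (group_ring A G).

HB.instance Definition _ := GRing.Zmodule.on AG.

Definition gr_one : AG := mkmalgU 1%g 1.

Definition gr_mul (a b : AG) : AG :=
  \sum_(g <- msupp a) \sum_(h <- msupp b) mkmalgU (g * h)%g (a@_g * b@_h).

Lemma gr_mulw (d1 d2 : {fset G}) (a b : AG) :
  msupp a `<=` d1 -> msupp b `<=` d2 ->
  gr_mul a b =
    \sum_(g <- d1) \sum_(h <- d2) mkmalgU (g * h)%g (a@_g * b@_h).
Proof.
move=> le1 le2; rewrite /gr_mul (big_fset_incl _ le1) /=.
  apply/eq_bigr=> k1 _; apply/big_fset_incl => // k _ /mcoeff_outdom ->.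
  by rewrite mulr0 monalgU0.
move=> k _ /mcoeff_outdom ak.
by rewrite big1 => // k' _; rewrite ak mul0r monalgU0.
Qed.

Lemma gr_mulDl : left_distributive gr_mul +%R.
Proof.
move=> a b c.
rewrite (gr_mulw (msuppD_le a b) (fsubset_refl (msupp c))).
rewrite (gr_mulw (fsubsetUl _ (msupp b)) (fsubset_refl (msupp c))).
rewrite (gr_mulw (fsubsetUr (msupp a) _) (fsubset_refl (msupp c))).
rewrite -big_split /=; apply/eq_bigr=> k1 _.
rewrite -big_split /=; apply/eq_bigr=> k2 _.
by rewrite mcoeffD mulrDl monalgUD.
Qed.

Lemma gr_mulDr : right_distributive gr_mul +%R.
Proof.
move=> c a b.
rewrite (gr_mulw (fsubset_refl (msupp c)) (msuppD_le a b)).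
rewrite (gr_mulw (fsubset_refl (msupp c)) (fsubsetUl _ (msupp b))).
rewrite (gr_mulw (fsubset_refl (msupp c)) (fsubsetUr (msupp a) _)).
rewrite -big_split /=; apply/eq_bigr=> k1 _.
rewrite -big_split /=; apply/eq_bigr=> k2 _.
by rewrite mcoeffD mulrDr monalgUD.
Qed.

Lemma gr_mul0l : left_zero 0 gr_mul.
Proof. by move=> a; apply: (addrI (gr_mul 0 a)); rewrite -gr_mulDl !addr0. Qed.

Lemma gr_mul0r : right_zero 0 gr_mul.
Proof. by move=> a; apply: (addrI (gr_mul a 0)); rewrite -gr_mulDr !addr0. Qed.

Lemma gr_mulUU (x y : A) (g h : G) :
  gr_mul (mkmalgU g x) (mkmalgU h y) = mkmalgU (g * h)%g (x * y).
Proof. by rewrite (gr_mulw msuppU_le msuppU_le) !big_seq_fset1 !mcoeffUU. Qed.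

Lemma gr_mul_suml I (s : seq I) (F : I -> AG) b :
  gr_mul (\sum_(i <- s) F i) b = \sum_(i <- s) gr_mul (F i) b.
Proof. exact: (big_morph (gr_mul^~ b) (fun x y => gr_mulDl x y b) (gr_mul0l b)). Qed.

Lemma gr_mul_sumr I (s : seq I) (F : I -> AG) b :
  gr_mul b (\sum_(i <- s) F i) = \sum_(i <- s) gr_mul b (F i).
Proof. exact: (big_morph (gr_mul b) (gr_mulDr b) (gr_mul0r b)). Qed.

Lemma gr_mul1l : left_id gr_one gr_mul.
Proof.
move=> a; rewrite {1}[a]monalgE gr_mul_sumr [RHS]monalgE.
by apply/eq_bigr=> g _; rewrite gr_mulUU mul1g mul1r.
Qed.

Lemma gr_mul1r : right_id gr_one gr_mul.
Proof.
move=> a; rewrite {1}[a]monalgE gr_mul_suml [RHS]monalgE.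
by apply/eq_bigr=> g _; rewrite gr_mulUU mulg1 mulr1.
Qed.

Lemma gr_mulA : associative gr_mul.
Proof.
move=> a b c; rewrite [a]monalgE.
set u := fun g : G => mkmalgU g a@_g.
rewrite (gr_mul_suml _ u b) (gr_mul_suml _ u) gr_mul_suml.
apply/eq_bigr=> g _; rewrite [b]monalgE.
set v := fun g : G => mkmalgU g b@_g.
rewrite (gr_mul_sumr _ v) (gr_mul_suml _ v) gr_mul_sumr gr_mul_suml.
apply/eq_bigr=> h _; rewrite [c]monalgE.
set w := fun g : G => mkmalgU g c@_g.
rewrite !(gr_mul_sumr _ w) gr_mul_sumr.
by apply/eq_bigr=> k _; rewrite /u /v /w !gr_mulUU mulgA mulrA.
Qed.

Lemma gr_one_neq0 : gr_one != 0.
Proof. by rewrite monalgU_eq0 oner_eq0. Qed.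

HB.instance Definition _ := GRing.Zmodule_isNzRing.Build AG
  gr_mulA gr_mul1l gr_mul1r gr_mulDl gr_mulDr gr_one_neq0.

Definition gr_aug (a : AG) : A := \sum_(g <- msupp a) a@_g.

Lemma gr_augw (d : {fset G}) (a : AG) :
  msupp a `<=` d -> gr_aug a = \sum_(g <- d) a@_g.
Proof.
by move=> le; rewrite /gr_aug (big_fset_incl _ le) // => k _ /mcoeff_outdom ->.
Qed.

Lemma gr_augU (g : G) (x : A) : gr_aug (mkmalgU g x) = x.
Proof. by rewrite (gr_augw msuppU_le) big_seq_fset1 mcoeffUU. Qed.

Lemma gr_augD : {morph gr_aug : a b / a + b}.
Proof.
move=> a b; rewrite (gr_augw (msuppD_le a b)).
rewrite (gr_augw (fsubsetUl (msupp a) (msupp b))).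
rewrite (gr_augw (fsubsetUr (msupp a) (msupp b))) -big_split /=.
by apply/eq_bigr=> k _; rewrite mcoeffD.
Qed.

Lemma gr_aug0 : gr_aug 0 = 0.
Proof. by apply: (addrI (gr_aug 0)); rewrite -gr_augD !addr0. Qed.

Lemma gr_aug1 : gr_aug 1 = 1.
Proof. exact: gr_augU. Qed.

Lemma gr_augM : {morph gr_aug : a b / a * b}.
Proof.
move=> a b; rewrite [a * b]/(gr_mul a b) /gr_mul.
rewrite (big_morph _ gr_augD gr_aug0) [gr_aug a]/gr_aug mulr_suml.
apply/eq_bigr=> g _; rewrite (big_morph _ gr_augD gr_aug0) [gr_aug b]/gr_aug mulr_sumr.
by apply/eq_bigr=> h _; rewrite gr_augU.
Qed.

End GroupRing.

(* The A[G]-module A with trivial G-action. *)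
Definition trivial_module (A : nzRingType) (G : groupType) : Type := A.

Section TrivialModule.
Variables (A : nzRingType) (G : groupType).
Local Notation T := (trivial_module A G).

HB.instance Definition _ := GRing.Zmodule.on T.

Definition triv_scale (a : group_ring A G) (r : T) : T := gr_aug a * (r : A).

Lemma triv_scaleA a b r : triv_scale a (triv_scale b r) = triv_scale (a * b) r.
Proof. by rewrite /triv_scale gr_augM mulrA. Qed.

Lemma triv_scale1 : left_id 1 triv_scale.
Proof. by move=> r; rewrite /triv_scale gr_aug1 mul1r. Qed.

Lemma triv_scaleDr : right_distributive triv_scale +%R.
Proof. by move=> a r s; apply: mulrDr. Qed.

Lemma triv_scaleDl r : {morph triv_scale^~ r : a b / a + b}.
Proof. by move=> a b; rewrite /triv_scale gr_augD mulrDl. Qed.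

HB.instance Definition _ := GRing.Zmodule_isLmodule.Build (group_ring A G) T
  triv_scaleA triv_scale1 triv_scaleDr triv_scaleDl.

End TrivialModule.

Definition finitely_generated (A : nzRingType) (M : lmodType A) : Prop :=
  exists (m : nat) (s : 'I_m -> M),
    forall x, exists c : 'I_m -> A, x = \sum_i c i *: s i.

Definition projective (A : nzRingType) (P : lmodType A) : Prop :=
  forall (M N : lmodType A) (g : {linear M -> N}) (f : {linear P -> N}),
    (forall y, exists x, g x = y) ->
    exists h : {linear P -> M}, forall x, g (h x) = f x.

Section Resolution.
Local Open Scope classical_set_scope.
Local Open Scope ring_scope.
Variables (R : subringClosed rat) (G : groupType).
Local Notation RG := (group_ring (subrat R) G).

(* cycles d e n is ker(d_n : P_n -> P_(n-1)), with d_0 = e the augmentation;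
   d i is the boundary map usually written with index i + 1. *)
Definition cycles (P : nat -> lmodType RG)
    (d : forall i, {linear P i.+1 -> P i})
    (e : {linear P 0 -> trivial_module (subrat R) G}) (n : nat) : set (P n) :=
  match n return set (P n) with
  | 0 => [set x | e x = 0]
  | i.+1 => [set x | d i x = 0]
  end.
Arguments cycles {P} d e n.

(* P_m -> ... -> P_0 -> R -> 0.  Only P_0, ..., P_m and the maps between them
   are constrained; the entries beyond m are irrelevant. *)
Record partial_resolution (m : nat) := PartialResolution {
  pr_mod : nat -> lmodType RG;
  pr_d : forall i, {linear pr_mod i.+1 -> pr_mod i};
  pr_aug : {linear pr_mod 0 -> trivial_module (subrat R) G};
  pr_fg : forall i, (i <= m)%N -> finitely_generated (pr_mod i);
  pr_proj : forall i, (i <= m)%N -> projective (pr_mod i);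
  pr_aug_surj : forall r, exists x, pr_aug x = r;
  pr_exact : forall i, (i < m)%N -> range (pr_d i) = cycles pr_d pr_aug i
}.

Definition type_FP (m : nat) : Prop := inhabited (partial_resolution m).

Definition gr_norm (a : RG) : rat := \sum_(g <- msupp a) `|val a@_g|.

Definition l1_norm (m : nat) (x : 'rV[RG]_m) : rat := \sum_j gr_norm (x ord0 j).

(* A finitely generated free module with a fixed finite basis is a module of
   row vectors 'rV[RG]_m. *)
Definition filling_norm (K : realType) (M : lmodType RG) (N : M -> K) : Prop :=
  exists (m : nat) (rho : {linear 'rV[RG]_m -> M}),
    (forall x, exists v, rho v = x) /\
    (forall x, N x = inf [set ratr (l1_norm v) | v in [set v | rho v = x]]).

Definition gr_of_int (a : group_ring int G) : RG :=
  \sum_(g <- msupp a) mkmalgU g (a@_g)%:~R.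

(* I is an integral part of the submodule M of P.  The Z[G]-module structure of
   P is the restriction of scalars along gr_of_int. *)
Record integral_part (P : lmodType RG) (M I : set P) : Prop := IntegralPart {
  ip_sub : I `<=` M;
  ip_0 : I 0;
  ip_add : forall x y, I x -> I y -> I (x + y);
  ip_scale : forall (a : group_ring int G) x, I x -> I (gr_of_int a *: x);
  ip_fg : exists (m : nat) (s : 'I_m -> P), (forall i, I (s i)) /\
    forall x, I x -> exists c : 'I_m -> group_ring int G,
      x = \sum_i gr_of_int (c i) *: s i;
  ip_gen : forall x, M x -> exists (m : nat) (s : 'I_m -> P) (c : 'I_m -> RG),
    (forall i, I (s i)) /\ x = \sum_i c i *: s i
}.

Record filling_data (K : realType) (n : nat) := FillingData {
  fd_res : partial_resolution n.+1;
  fd_int : set (pr_mod fd_res n);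
  fd_norm : pr_mod fd_res n -> K;
  fd_normS : pr_mod fd_res n.+1 -> K;
  fd_intP :
    integral_part (cycles (pr_d fd_res) (pr_aug fd_res) n) fd_int;
  fd_normP : filling_norm fd_norm;
  fd_normSP : filling_norm fd_normS
}.
Arguments fd_int {K n} _ _.
Arguments fd_norm {K n} _ _.
Arguments fd_normS {K n} _ _.

Local Open Scope ereal_scope.

Definition boundary_norm (K : realType) (n : nat) (D : filling_data K n)
    (x : pr_mod (fd_res D) n) : \bar K :=
  ereal_inf [set (fd_normS D y)%:E | y in [set y | pr_d (fd_res D) n y = x]].

(* ereal_sup set0 = -oo, whereas the supremum is taken in [0, +oo]. *)
Definition sup0 (K : realType) (S : set (\bar K)) : \bar K :=
  if `[< S = set0 >] then 0 else ereal_sup S.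

Definition FV (K : realType) (n : nat) (D : filling_data K n) (k : nat) :
    \bar K :=
  sup0 [set boundary_norm x | x in
         [set x | fd_int D x /\ (fd_norm D x <= k%:R)%R]].

End Resolution.

Section Growth.
Variable K : realType.
Implicit Types f g : nat -> \bar K.
Local Open Scope ereal_scope.

Definition growth_le f g : Prop :=
  exists C : nat, (0 < C)%N /\
    forall k : nat,
      f k <= C%:R%:E * g (C * k + C)%N + (C * k + C)%:R%:E.

Definition growth_equiv f g : Prop := growth_le f g /\ growth_le g f.

End Growth.

(* Main.v *)
(* Two resolutions are compared by chain maps f, g and a homotopy h from g f to
   the identity, all of which are bounded for the filling norms because they
   lift to the free modules presenting the norms.  The map f need not carry the
   integral part K_n of one resolution into the integral part L_n of the other;
   but every denominator of an element of R is invertible in R, so there is an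
   integer m, invertible in R, with m f(K_n) contained in L_n.  A filling y of
   m f(x) then yields the filling g(y)/m - h(x) of x, whose norm is bounded
   linearly in that of y and in that of x. *)
Require Import Defs.
From HB Require Import structures.
From mathcomp Require Import all_boot all_order all_algebra finmap.
From mathcomp Require Import monalg.
From mathcomp Require Import boolp classical_sets reals constructive_ereal ereal.

Set Implicit Arguments.
Unset Strict Implicit.
Unset Printing Implicit Defensive.

Import Order.TTheory GRing.Theory Num.Theory.

Local Open Scope classical_set_scope.
Local Open Scope ring_scope.

(** * Lifting along free and projective modules *)

Section LinearMaps.
Variable A : nzRingType.

Section Combination.
Variables (M : lmodType A) (m : nat) (s : 'I_m -> M).

Definition row_comb (v : 'rV[A]_m) : M := \sum_j v ord0 j *: s j.

Lemma row_comb_linear : linear row_comb.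
Proof.
move=> a u v; rewrite /row_comb scaler_sumr -big_split /=.
by apply: eq_bigr => j _; rewrite !mxE scalerDl scalerA.
Qed.

HB.instance Definition _ :=
  GRing.isLinear.Build A 'rV[A]_m M *:%R row_comb row_comb_linear.
End Combination.

Lemma linear_row_comb (M : lmodType A) m (f : {linear 'rV[A]_m -> M}) v :
  f v = row_comb (fun j => f (delta_mx ord0 j)) v.
Proof.
rewrite {1}[v]matrix_sum_delta big_ord1 linear_sum.
by apply: eq_bigr => j _; rewrite linearZ.
Qed.

(** Preimages are chosen for the values of [u] on the basis. Surjectivity of [d] is replaced by the
    range of [u] lying in that of [d], which is the form that exactness supplies. *)
Lemma free_lift (M N : lmodType A) m (d : {linear M -> N})
    (u : {linear 'rV[A]_m -> N}) :
  (forall v, exists y, d y = u v) ->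
  exists s : 'I_m -> M, forall v, d (row_comb s v) = u v.
Proof.
move=> ex; have /choice[s sP] : forall j, exists y, d y = u (delta_mx ord0 j).
  by move=> j; exact: ex.
exists s => v; rewrite (linear_row_comb u) linear_sum.
by apply: eq_bigr => j _; rewrite linearZ sP.
Qed.

(* A finitely generated projective module is a retract of some A^m, so it is
   enough to lift over the basis of A^m. *)
Lemma projective_lift (P M N : lmodType A) (d : {linear M -> N})
    (u : {linear P -> N}) :
  finitely_generated P -> projective P ->
  (forall x, exists y, d y = u x) ->
  exists h : {linear P -> M}, forall x, d (h x) = u x.
Proof.
move=> [m [t tP]] projP ex.
have surj x : exists v, row_comb t v = x.
  have [c ->] := tP x; exists (\row_j c j).
  by apply: eq_bigr => j _; rewrite mxE.
(* Projectivity is applied to the identity of [P], giving a linear section [r] of the presentation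
   [row_comb t]. *)
have [r rP] := projP _ _ (row_comb t) idfun surj.
have [s sP] := @free_lift M N m d (u \o row_comb t) (fun v => ex _).
exists (row_comb s \o r) => x /=.
by rewrite sP /= rP.
Qed.

End LinearMaps.

(** * The l1-norm on group rings and free modules *)

Section Norms.
Variables (R : subringClosed rat) (G : groupType).
Local Notation RG := (group_ring (subrat R) G).
Implicit Types a b : RG.

(* [val] unfolds to [proj1_sig] on [subrat R], where the generic morphism
   lemmas do not unify. *)
Let subrat_val0 : val (0 : subrat R) = 0. Proof. exact: (rmorph0 val). Qed.
Let subrat_valN (x : subrat R) : val (- x) = - val x.
Proof. exact: (rmorphN val). Qed.
Let subrat_valD (x y : subrat R) : val (x + y) = val x + val y.
Proof. exact: (rmorphD val). Qed.
Let subrat_valM (x y : subrat R) : val (x * y) = val x * val y.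
Proof. exact: (rmorphM val). Qed.

Lemma gr_normw (d : {fset G}) a :
  (msupp a `<=` d)%fset -> gr_norm a = \sum_(g <- d) `|val a@_g|.
Proof.
move=> le; rewrite /gr_norm (big_fset_incl _ le) // => k _ /mcoeff_outdom ->.
by rewrite subrat_val0 normr0.
Qed.

Lemma gr_norm_ge0 a : 0 <= gr_norm a.
Proof. by apply: sumr_ge0 => g _; exact: normr_ge0. Qed.

Lemma gr_norm0 : gr_norm (0 : RG) = 0.
Proof. by apply: big1_seq => g; rewrite msupp0 in_fset0 andbF. Qed.

Lemma gr_normU (g : G) (x : subrat R) :
  gr_norm (mkmalgU g x : RG) = `|val x|.
Proof. by rewrite (gr_normw msuppU_le) big_seq_fset1 mcoeffUU. Qed.

Lemma gr_normN a : gr_norm (- a) = gr_norm a.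
Proof.
rewrite (@gr_normw (msupp a)) ?msuppN //.
by apply: eq_bigr => g _; rewrite mcoeffN subrat_valN normrN.
Qed.

Lemma gr_normD a b : gr_norm (a + b) <= gr_norm a + gr_norm b.
Proof.
rewrite (gr_normw (msuppD_le a b)).
rewrite (gr_normw (fsubsetUl (msupp a) (msupp b))).
rewrite (gr_normw (fsubsetUr (msupp a) (msupp b))) -big_split /=.
by apply: ler_sum => g _; rewrite mcoeffD subrat_valD ler_normD.
Qed.

Lemma gr_norm_sum I (r : seq I) (F : I -> RG) :
  gr_norm (\sum_(i <- r) F i) <= \sum_(i <- r) gr_norm (F i).
Proof.
elim: r => [|i r IHr]; first by rewrite !big_nil gr_norm0.
by rewrite !big_cons (le_trans (gr_normD _ _)) // lerD2l.
Qed.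

Lemma gr_normM a b : gr_norm (a * b) <= gr_norm a * gr_norm b.
Proof.
apply: le_trans (gr_norm_sum _ _) _; rewrite [gr_norm a]/gr_norm mulr_suml.
apply: ler_sum => g _; apply: le_trans (gr_norm_sum _ _) _.
rewrite [gr_norm b]/gr_norm mulr_sumr.
by apply: ler_sum => h _; rewrite gr_normU subrat_valM normrM.
Qed.

Variable m : nat.
Implicit Types u v : 'rV[RG]_m.

Lemma l1_norm_ge0 v : 0 <= l1_norm v.
Proof. by apply: sumr_ge0 => j _; exact: gr_norm_ge0. Qed.

Lemma l1_norm0 : l1_norm (0 : 'rV[RG]_m) = 0.
Proof. by apply: big1 => j _; rewrite mxE gr_norm0. Qed.

Lemma l1_normB u v : l1_norm (u - v) <= l1_norm u + l1_norm v.
Proof.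
rewrite -big_split; apply: ler_sum => j _; rewrite !mxE.
by rewrite (le_trans (gr_normD _ _)) // gr_normN.
Qed.

Lemma l1_normZ a v : l1_norm (a *: v) <= gr_norm a * l1_norm v.
Proof.
by rewrite mulr_sumr; apply: ler_sum => j _; rewrite mxE gr_normM.
Qed.

Lemma l1_norm_sum I (r : seq I) (F : I -> 'rV[RG]_m) :
  l1_norm (\sum_(i <- r) F i) <= \sum_(i <- r) l1_norm (F i).
Proof.
elim: r => [|i r IHr]; first by rewrite !big_nil l1_norm0.
rewrite !big_cons -[\sum_(j <- r) F j]opprK.
apply: le_trans (l1_normB _ _) _; rewrite lerD2l; apply: le_trans IHr.
by apply: ler_sum => j _; rewrite mxE gr_normN.
Qed.

End Norms.

(** This is the boundedness of linear maps between based free modules: each [l1_norm (s j)] is at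
    most the sum of all of them. *)
Lemma l1_norm_row_comb (R : subringClosed rat) (G : groupType) m p
    (s : 'I_m -> 'rV[group_ring (subrat R) G]_p) v :
  l1_norm (row_comb s v) <= (\sum_j l1_norm (s j)) * l1_norm v.
Proof.
apply: le_trans (l1_norm_sum _ _) _; rewrite mulr_sumr.
apply: ler_sum => j _; apply: le_trans (l1_normZ _ _) _.
rewrite mulrC ler_wpM2r ?gr_norm_ge0 // (bigD1 j) //= lerDl.
by apply: sumr_ge0 => i _; exact: l1_norm_ge0.
Qed.

(** * Filling norms and bounded maps between normed modules *)

Section FillingNorm.
Variables (R : subringClosed rat) (G : groupType) (K : realType).
Local Notation RG := (group_ring (subrat R) G).

Section Presentation.
Variables (M : lmodType RG) (N : M -> K) (m : nat).
Variable rho : {linear 'rV[RG]_m -> M}.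
Hypothesis rho_surj : forall x, exists v, rho v = x.
Hypothesis NE :
  forall x, N x = inf [set ratr (l1_norm v) | v in [set v | rho v = x]].

Lemma filling_norm_le v : N (rho v) <= ratr (l1_norm v).
Proof.
rewrite NE; apply: ge_inf; last by exists v.
by exists 0 => _ [w _ <-]; rewrite ler0q l1_norm_ge0.
Qed.

Lemma le_filling_norm x c :
  (forall v, rho v = x -> c <= ratr (l1_norm v)) -> c <= N x.
Proof.
move=> cP; rewrite NE; apply: lb_le_inf.
  by have [v vx] := rho_surj x; exists (ratr (l1_norm v)), v.
by move=> _ [v /= vx <-]; exact: cP.
Qed.

End Presentation.

Lemma filling_norm_ge0 (M : lmodType RG) (N : M -> K) x :
  filling_norm N -> 0 <= N x.
Proof.
move=> [m [rho [surj NE]]]; apply: (le_filling_norm surj NE) => v _.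
by rewrite ler0q l1_norm_ge0.
Qed.

Lemma filling_norm0 (M : lmodType RG) (N : M -> K) : filling_norm N -> N 0 = 0.
Proof.
move=> fN; apply: le_anti; rewrite filling_norm_ge0 // andbT.
have [m [rho [surj NE]]] := fN.
by have := filling_norm_le NE 0; rewrite linear0 l1_norm0 rmorph0.
Qed.

Lemma filling_normB (M : lmodType RG) (N : M -> K) x y :
  filling_norm N -> N (x - y) <= N x + N y.
Proof.
move=> [m [rho [surj NE]]]; rewrite -lerBlDr.
(* One infimum is treated at a time: [v] lifts [x], then [w] lifts [y], and [v - w] lifts
   [x - y]. *)
apply: (le_filling_norm surj NE) => v <-; rewrite lerBlDr -lerBlDl.
apply: (le_filling_norm surj NE) => w <-; rewrite lerBlDl -linearB.
apply: le_trans (filling_norm_le NE _) _.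
by rewrite -rmorphD ler_rat l1_normB.
Qed.

Lemma filling_norm_bound (M M' : lmodType RG) (N : M -> K) (N' : M' -> K)
    m m' (rho : {linear 'rV[RG]_m -> M}) (rho' : {linear 'rV[RG]_m' -> M'})
    (f : M -> M') (phi : 'rV[RG]_m -> 'rV[RG]_m') (q : rat) :
  (forall x, exists v, rho v = x) ->
  (forall x, N x = inf [set ratr (l1_norm v) | v in [set v | rho v = x]]) ->
  (forall x, N' x = inf [set ratr (l1_norm v) | v in [set v | rho' v = x]]) ->
  (forall v, rho' (phi v) = f (rho v)) ->
  (forall v, l1_norm (phi v) <= q * l1_norm v) ->
  exists C : nat, forall x, N' (f x) <= C%:R * N x.
Proof.
move=> surj NE NE' phiP phi_le; set C := (Num.bound `|q|).+1.
have C0 : 0 < C%:R :> K by rewrite ltr0n.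
have qC : q <= C%:R.
  rewrite (le_trans (ler_norm q)) // ltW // (lt_trans (archi_boundP _)) //.
  by rewrite ltr_nat.
exists C => x; rewrite -ler_pdivrMl //.
apply: (le_filling_norm surj NE) => v <-; rewrite ler_pdivrMl // -phiP.
apply: le_trans (filling_norm_le NE' _) _.
rewrite -(ratr_nat K C) -rmorphM ler_rat.
by rewrite (le_trans (phi_le v)) // ler_wpM2r ?l1_norm_ge0.
Qed.

Lemma linear_filling_norm_bound (M M' : lmodType RG) (N : M -> K)
    (N' : M' -> K) (f : {linear M -> M'}) :
  filling_norm N -> filling_norm N' ->
  exists C : nat, forall x, N' (f x) <= C%:R * N x.
Proof.
move=> [m [rho [surj NE]]] [m' [rho' [surj' NE']]].
have [s sP] := @free_lift _ _ _ _ rho' (f \o rho) (fun v => surj' _).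
apply: (filling_norm_bound surj NE NE' sP) => v.
exact: l1_norm_row_comb.
Qed.

Lemma scale_filling_norm_bound (M : lmodType RG) (N : M -> K) (a : RG) :
  filling_norm N -> exists C : nat, forall x, N (a *: x) <= C%:R * N x.
Proof.
move=> [m [rho [surj NE]]].
apply: (@filling_norm_bound _ _ _ _ _ _ rho rho ( *:%R a) ( *:%R a)
          (gr_norm a) surj NE NE).
  by move=> v; rewrite linearZ.
by move=> v; exact: l1_normZ.
Qed.

End FillingNorm.

(** * Clearing denominators to reach an integral part *)

Section IntegralParts.
Variables (R : subringClosed rat) (G : groupType).
Local Notation RG := (group_ring (subrat R) G).

Definition invertible_nat (m : nat) : Prop :=
  exists r : subrat R, r * m%:R = 1.

Lemma invertible_nat_mul m p :
  invertible_nat m -> invertible_nat p -> invertible_nat (m * p).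
Proof.
move=> [r rm] [s sp]; exists (r * s).
by rewrite natrM mulrACA rm sp mulr1.
Qed.

(* Bezout: if u num + v den = 1 then 1 / den = u (num / den) + v lies in R. *)
Lemma subrat_denominator (q : subrat R) :
  exists m (z : int), invertible_nat m /\ q *+ m = z%:~R.
Proof.
exists `|denq (val q)|%N, (numq (val q)).
have dE : (`|denq (val q)|%N : int) = denq (val q) by rewrite absz_denq.
have qd : q *+ `|denq (val q)|%N = (numq (val q))%:~R.
  apply: val_inj; have valz : val (_%:~R : subrat R) = _ := rmorph_int val _.
  rewrite raddfMn /= valz -{1}[val q]divq_num_den.
  rewrite -mulr_natr -[_%:R]/((`|denq (val q)|%N : int)%:~R) dE.
  by rewrite divfK // intr_eq0 denq_neq0.
split=> //.
have /coprimezP[[u v] /= uv] : coprimez (numq (val q)) (denq (val q)).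
  by rewrite coprimezE coprime_num_den.
exists (u%:~R * q + v%:~R); rewrite mulrDl -mulrA !mulr_natr qd.
rewrite -[_%:~R *+ _]mulr_natr -[_%:R]/((`|denq (val q)|%N : int)%:~R) dE.
by rewrite -!rmorphM -rmorphD uv.
Qed.

Variables (P : lmodType RG) (C I : set P).
Hypothesis IP : integral_part C I.

Definition has_integral_multiple (x : P) : Prop :=
  exists m, invertible_nat m /\ I (x *+ m).

Lemma integral_part_sum J (r : seq J) (F : J -> P) :
  (forall j, I (F j)) -> I (\sum_(j <- r) F j).
Proof.
move=> IF; elim: r => [|j r IHr]; first by rewrite big_nil; exact: ip_0 IP.
by rewrite big_cons; apply: (ip_add IP).
Qed.

Lemma integral_part_muln x m : I x -> I (x *+ m).
Proof.
move=> Ix; elim: m => [|m IHm]; first by rewrite mulr0n; exact: ip_0 IP.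
by rewrite mulrS; apply: (ip_add IP).
Qed.

Lemma integral_multiple_sum J (r : seq J) (F : J -> P) :
  (forall j, has_integral_multiple (F j)) ->
  has_integral_multiple (\sum_(j <- r) F j).
Proof.
move=> IF; elim: r => [|j r [m [m1 Im]]].
  rewrite big_nil; exists 1%N; split; first by exists 1; rewrite mulr1.
  exact: ip_0 IP.
have [p [p1 Ip]] := IF j.
rewrite big_cons; exists (p * m)%N; split; first exact: invertible_nat_mul.
rewrite mulrnDl mulrnA mulnC mulrnA.
by apply: (ip_add IP); exact: integral_part_muln.
Qed.

Lemma gr_of_intU (g : G) (z : int) :
  gr_of_int R (mkmalgU g z) = mkmalgU g z%:~R.
Proof.
rewrite /gr_of_int (big_fset_incl _ msuppU_le) /=.
  by rewrite big_seq_fset1 mcoeffUU.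
by move=> h _ /mcoeff_outdom ->; rewrite monalgU0.
Qed.

(** Split [a] into monomials; clearing the denominator of a coefficient turns its monomial into an
    element of Z[G], which preserves [I]. *)
Lemma integral_multiple_scale (a : RG) x : I x -> has_integral_multiple (a *: x).
Proof.
move=> Ix; rewrite [a]monalgE scaler_suml.
apply: integral_multiple_sum => g.
have [m [z [m1 qz]]] := subrat_denominator a@_g.
exists m; split=> //; rewrite scalerMnl -monalgUMn qz -gr_of_intU.
exact: (ip_scale IP).
Qed.

Lemma integral_multiple x : C x -> has_integral_multiple x.
Proof.
move=> /(ip_gen IP)[m [s [c [Is ->]]]].
by apply: integral_multiple_sum => j; exact: integral_multiple_scale.
Qed.

Lemma integral_multiple_fin m (s : 'I_m -> P) :
  (forall i, C (s i)) ->
  exists p, invertible_nat p /\ forall i, I (s i *+ p).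
Proof.
elim: m s => [|m IHm] s Cs.
  by exists 1%N; split; [exists 1; rewrite mulr1|case].
have [p [p1 Ip]] := IHm _ (fun i => Cs (lift ord0 i)).
have [q [q1 Iq]] := integral_multiple (Cs ord0).
exists (p * q)%N; split; first exact: invertible_nat_mul.
move=> i; have [j ->|->] := unliftP ord0 i.
  by rewrite mulrnA; exact: integral_part_muln.
by rewrite mulnC mulrnA; exact: integral_part_muln.
Qed.

End IntegralParts.

(** Finite generation of [I] over Z[G] makes [m] uniform: it is chosen for the images of the
    generators, and Z[G]-combinations stay in [I']. *)
Lemma integral_part_image (R : subringClosed rat) (G : groupType)
    (P Q : lmodType (group_ring (subrat R) G)) (C I : set P) (C' I' : set Q)
    (f : {linear P -> Q}) :
  integral_part C I -> integral_part C' I' ->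
  (forall x, C x -> C' (f x)) ->
  exists m, invertible_nat R m /\ forall x, I x -> I' (f x *+ m).
Proof.
move=> IP IP' fC; have [k [s [Is sP]]] := ip_fg IP.
have [m [m1 Im]] := integral_multiple_fin IP'
  (fun i => fC _ (ip_sub IP (Is i))).
exists m; split=> // x /sP[c ->].
rewrite linear_sum -sumrMnl; apply: (integral_part_sum IP') => j.
rewrite linearZ scalerMnr. by apply: (ip_scale IP'); exact: Im.
Qed.

(** * Comparison of partial resolutions *)

Section Resolutions.
Variables (R : subringClosed rat) (G : groupType).
Local Notation RG := (group_ring (subrat R) G).

Local Notation cyc r i := (@cycles _ _ _ (@pr_d _ _ _ r) (@pr_aug _ _ _ r) i).

Lemma cycles_boundary m (r : partial_resolution R G m) i z :
  (i < m)%N -> cyc r i z -> exists y, pr_d r i y = z.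
Proof. by move=> im; rewrite -(pr_exact r im) => -[y _ <-]; exists y. Qed.

Lemma boundary_cycles m (r : partial_resolution R G m) i y :
  (i < m)%N -> cyc r i (pr_d r i y).
Proof. by move=> im; rewrite -(pr_exact r im); exists y. Qed.

(** The degrees [i] and [j] are independent so that the lemma yields both chain maps ([i] equal to
    [j.+1]) and homotopies ([i] equal to [j]). *)
Lemma resolution_lift m (r s : partial_resolution R G m) i j
    (u : {linear pr_mod r i -> pr_mod s j}) :
  (i <= m)%N -> (j < m)%N -> (forall x, cyc s j (u x)) ->
  exists h : {linear pr_mod r i -> pr_mod s j.+1},
    forall x, pr_d s j (h x) = u x.
Proof.
move=> im jm uC; apply: (projective_lift (@pr_fg _ _ _ r i im) (@pr_proj _ _ _ r i im)).
by move=> x; exact: cycles_boundary.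
Qed.

Lemma resolution_aug_lift m (r s : partial_resolution R G m) :
  exists f : {linear pr_mod r 0 -> pr_mod s 0},
    forall x, pr_aug s (f x) = pr_aug r x.
Proof.
apply: (projective_lift (@pr_fg _ _ _ r 0 _) (@pr_proj _ _ _ r 0 _)) => //.
by move=> x; exact: (pr_aug_surj s).
Qed.


(* The usual comparison of resolutions, keeping only what is needed to climb
   one degree: the chain maps preserve cycles and the homotopy is only used on
   cycles. *)
Lemma resolution_comparison m (r s : partial_resolution R G m) i :
  (i < m)%N ->
  exists (f : {linear pr_mod r i -> pr_mod s i})
         (g : {linear pr_mod s i -> pr_mod r i})
         (h : {linear pr_mod r i -> pr_mod r i.+1}),
    [/\ forall x, cyc r i x -> cyc s i (f x),
        forall y, cyc s i y -> cyc r i (g y)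
      & forall x, cyc r i x -> pr_d r i (h x) = g (f x) - x].
Proof.
elim: i => [|i IHi] im.
  have [f fP] := resolution_aug_lift r s.
  have [g gP] := resolution_aug_lift s r.
  have [|h hP] := @resolution_lift _ r r 0 0 ((g \o f) \- idfun) (leq0n m) im.
    by move=> x /=; rewrite linearB gP fP subrr.
  exists f, g, h; split=> [x /= xC|y /= yC|x _]; last exact: hP.
    by rewrite fP.
  by rewrite gP.
have im' := ltnW im; have [f [g [h [fC gC hC]]]] := IHi im'.
have [|f' f'P] := @resolution_lift _ r s i.+1 i (f \o pr_d r i) im' im'.
  by move=> x; apply: fC; exact: boundary_cycles.
have [|g' g'P] := @resolution_lift _ s r i.+1 i (g \o pr_d s i) im' im'.
  by move=> x; apply: gC; exact: boundary_cycles.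
(* The map to lift is g'f' - id - hd. Its values are cycles by the homotopy identity one degree
   lower, applied to the cycle dx; on cycles the term hd vanishes. *)
have [|h' h'P] := @resolution_lift _ r r i.+1 i.+1
    ((g' \o f') \- idfun \- (h \o pr_d r i)) im' im.
  move=> x /=; rewrite !linearB g'P /= f'P /= hC ?subrr //.
  exact: boundary_cycles.
exists f', g', h'; split=> [x /= xC|y /= yC|x /= xC].
- by rewrite f'P /= xC linear0.
- by rewrite g'P /= yC linear0.
- by rewrite h'P /= xC linear0 subr0.
Qed.

End Resolutions.

(** * Comparison of filling functions *)

Section FillingFunction.
Variables (R : subringClosed rat) (G : groupType) (K : realType) (n : nat).
Local Notation RG := (group_ring (subrat R) G).
Implicit Type D : filling_data R G K n.
Local Open Scope ereal_scope.

Lemma FV_sup D k x :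
  @fd_int _ _ _ _ D x -> (@fd_norm _ _ _ _ D x <= k%:R)%R ->
  boundary_norm x <= FV D k.
Proof.
move=> Ix xk; rewrite /FV /Defs.sup0; case: ifPn => [/asboolP S0|_].
  have : set0 (boundary_norm x) by rewrite -S0; exists x.
  by [].
by apply: ereal_sup_ubound; exists x.
Qed.

Lemma FV_le D k (b : \bar K) : 0 <= b ->
  (forall x, @fd_int _ _ _ _ D x -> (@fd_norm _ _ _ _ D x <= k%:R)%R ->
    boundary_norm x <= b) ->
  FV D k <= b.
Proof.
move=> b0 bP; rewrite /FV /Defs.sup0; case: ifP => // _.
by apply: ge_ereal_sup => _ [x [Ix xk] <-]; exact: bP.
Qed.

Lemma boundary_norm_ge0 D (x : pr_mod (fd_res D) n) : 0 <= boundary_norm x.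
Proof.
apply: le_ereal_inf_tmp => _ [y _ <-].
by rewrite lee_fin; exact: filling_norm_ge0 (fd_normSP D).
Qed.

Lemma FV_ge0 D k : 0 <= FV D k.
Proof.
apply: le_trans (boundary_norm_ge0 0%R) _.
apply: FV_sup; first exact: ip_0 (fd_intP D).
by rewrite (filling_norm0 (fd_normP D)).
Qed.

Lemma boundary_norm_le D y :
  boundary_norm (pr_d (fd_res D) n y) <= (@fd_normS _ _ _ _ D y)%:E.
Proof. by apply: ereal_inf_lbound; exists y. Qed.


(* If d y = m f x, then z = a g' y - h x with a = 1/m satisfies d z = x. *)
Lemma FV_growth_le D1 D2 : growth_le (FV D1) (FV D2).
Proof.
have [f [g [h [fC gC hC]]]] :=
  resolution_comparison (fd_res D1) (fd_res D2) (ltnSn n).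
(* Extending [g] to the top degree carries fillings for [D2] to fillings for [D1]. *)
have [|g' g'P] := @resolution_lift _ _ _ (fd_res D2) (fd_res D1) n.+1 n
    (g \o pr_d (fd_res D2) n) (leqnn _) (ltnSn n).
  by move=> y; apply: gC; exact: boundary_cycles.
have [m [[q qm] Im]] := integral_part_image (fd_intP D1) (fd_intP D2) fC.
pose a : RG := mkmalgU 1%g q.
have am : (a * m%:R = 1)%R by rewrite mulr_natr -monalgUMn -mulr_natr qm.
have [A1 fA] := linear_filling_norm_bound f (fd_normP D1) (fd_normP D2).
have [A2 mA] := scale_filling_norm_bound (m%:R : RG) (fd_normP D2).
have [B1 gB] := linear_filling_norm_bound g' (fd_normSP D2) (fd_normSP D1).
have [B2 aB] := scale_filling_norm_bound a (fd_normSP D1).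
have [H hB] := linear_filling_norm_bound h (fd_normP D1) (fd_normSP D1).
(* The three summands bound m f, a g' and h respectively; the successor makes [C] positive. *)
pose C := (A2 * A1 + (B2 * B1 + H)).+1.
have AC : (A2 * A1 <= C)%N := leqW (leq_addr _ _).
have BHC : (B2 * B1 + H <= C)%N := leqW (leq_addl _ _).
have BC : (B2 * B1 <= C)%N := leq_trans (leq_addr _ _) BHC.
exists C; split=> // k; apply: FV_le => [|x Ix xk].
  by rewrite adde_ge0 ?mule_ge0 ?FV_ge0.
have N1x : (0 <= @fd_norm _ _ _ _ D1 x)%R := filling_norm_ge0 x (fd_normP D1).
pose w := (f x *+ m)%R.
have wk : (@fd_norm _ _ _ _ D2 w <= (C * k + C)%:R)%R.
  rewrite /w -scaler_nat; apply: le_trans (mA _) _.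
  apply: (@le_trans _ _ (A2%:R * (A1%:R * k%:R))%R).
    by apply: ler_wpM2l => //; apply: le_trans (fA _) _; exact: ler_wpM2l.
  rewrite -!natrM ler_nat mulnA (leq_trans _ (leq_addr _ _)) //.
  by rewrite leq_mul2r AC orbT.
have := FV_sup (Im _ Ix) wk; have := FV_ge0 D2 (C * k + C).
(* Nonnegativity excludes the value -oo; at +oo the right-hand side is infinite because [C] is
   positive. *)
case: (FV D2 (C * k + C)) => [v| |] // v0 wv; last first.
  by rewrite gt0_muley ?lte_fin ?ltr0n // addye ?leey.
(* The infimum over fillings need not be attained, so a filling of norm below [v + 1] is taken. *)
have : boundary_norm w < (v + 1)%:E.
  by rewrite (le_lt_trans wv) // lte_fin ltrDl.
move=> /ereal_inf_lt[_ [y /= yw <-]]; rewrite lte_fin => yv.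
(* Here d(a g' y) = a g(m f x) = g(f x), while d(h x) = g(f x) - x. *)
have zx : pr_d (fd_res D1) n (a *: g' y - h x)%R = x.
  rewrite linearB linearZ g'P /= yw hC; last exact: ip_sub (fd_intP D1) _ Ix.
  by rewrite /w -scaler_nat linearZ scalerA am scale1r opprB addrC subrK.
rewrite -{1}zx; apply: le_trans (boundary_norm_le _) _.
rewrite -EFinM -EFinD lee_fin.
apply: le_trans (filling_normB _ _ (fd_normSP D1)) _.
rewrite lee_fin in v0.
apply: (@le_trans _ _ ((B2 * B1)%:R * (v + 1) + H%:R * k%:R)%R).
  apply: lerD; last by apply: le_trans (hB _) _; exact: ler_wpM2l.
  apply: le_trans (aB _) _; rewrite natrM -mulrA; apply: ler_wpM2l => //.
  by apply: le_trans (gB _) _; apply: ler_wpM2l => //; exact: ltW.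
(* The slack 1 contributes [B2 * B1], absorbed by the additive [C]; the homotopy term [H * k] is
   absorbed by [C * k]. *)
rewrite mulrDr mulr1 -addrA; apply: lerD.
  by apply: ler_wpM2r => //; rewrite ler_nat.
rewrite addrC -natrM -natrD ler_nat; apply: leq_add => //.
by rewrite leq_mul2r (leq_trans _ BHC) ?leq_addl ?orbT.
Qed.

End FillingFunction.

Theorem theorem3p3 (R : subringClosed rat) (n : nat) (hn : (1 <= n)%N)
    (G : groupType) (hG : type_FP R G n.+1)
    (K : realType) (D1 D2 : filling_data R G K n) :
  growth_equiv (FV D1) (FV D2).
Proof. by split; exact: FV_growth_le. Qed.
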